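(* There exists a positive real number $c$ such that for every natural number $d$ and every positive real number $\alpha$ the following holds for all $m \ge \alpha^{-cd^2}$. If $G$ is a graph on $m$ vertices with minimum degree at least $\alpha m$, then $G$ is universal for the family of $d$-degenerate bipartite graphs on at most $d^{-1}2^{-21}\alpha^{72d}m$ vertices.
   Context: A graph is $d$-degenerate if every subgraph of it has a vertex of degree at most $d$. A graph $G$ is universal for a family $\mathcal{F}$ of graphs if it contains every $F\in\mathcal{F}$ as a (not necessarily induced) subgraph. *)

(* Defs.v *)
From HB Require Import structures.
From mathcomp Require Import all_boot all_order all_algebra.
From mathcomp Require Import all_classical all_reals all_analysis.

Set Implicit Arguments.
Unset Strict Implicit.
Unset Printing Implicit Defensive.

Record sgraph := SGraph {
  vertex :> finType;
  adj : rel vertex;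
  adj_sym : symmetric adj;
  adj_irrefl : irreflexive adj
}.

Definition degree (G : sgraph) (v : G) : nat := #|[pred w | adj v w]|.

(* [H] is isomorphic to a (not necessarily induced) subgraph of [G]. *)
Definition is_subgraph (H G : sgraph) : Prop :=
  exists2 f : H -> G, injective f & forall u v : H, adj u v -> adj (f u) (f v).

(* Subgraphs are taken to have at least one vertex, otherwise no graph would
   be degenerate. *)
Definition degenerate (d : nat) (G : sgraph) : Prop :=
  forall H : sgraph, is_subgraph H G -> (0 < #|H|)%N ->
    exists v : H, (degree v <= d)%N.

Definition bipartite (G : sgraph) : Prop :=
  exists side : G -> bool, forall u v : G, adj u v -> side u != side v.

Definition universal (G : sgraph) (F : sgraph -> Prop) : Prop :=
  forall H : sgraph, F H -> is_subgraph H G.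

(* Main.v *)
Require Import Defs.
From HB Require Import structures.
From mathcomp Require Import all_boot all_order all_algebra.
From mathcomp Require Import ring lra zify.
From mathcomp Require Import all_classical all_reals all_analysis.
From mathcomp Require Import fintype finset.

(** Dependent random choice, applied twice, gives vertex sets X and Y of G such
    that, for random d-tuples t in X, the 6d-th moment of [#|G| / #|N(t) :&: Y|]
    is at most [alpha ^- O(d ^ 2)], and likewise with X and Y exchanged.

    Embed the vertices of H one at a time along a d-degenerate order.  The cost of
    a vertex u that is not yet embedded is such a moment, taken over the images
    that its earlier, not yet embedded neighbours would have if they were uniformly
    random in X (or Y).  Placing a neighbour x of u uniformly in its candidate set
    multiplies this moment by at most [#|X|] over the number of candidates, which
    may be large; but if the exponent of the moment is lowered by 2 whenever a
    neighbour of u is placed, then by Young's inequality the factor becomes an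
    additive term of at most [1 / (2 d)] times the cost of x.  Weights that solve
    w(x) = 1 + (sum of w(u) over the later neighbours u of x) / (2 d) add up to at
    most 2 #|H| and make the weighted total cost drop by the cost of x, which
    compensates for the candidates that other vertices lose by the use of the image
    of x.  So the total cost stays at most 4 #|H|, and no vertex ever runs out of
    candidates.

    When d (1 - alpha) < 1/2, every d-tuple has at least #|G| / 2 common neighbours
    and a plain greedy embedding works; otherwise [alpha ^+ (2 * d) <= 1 / 2], which
    absorbs the constants. *)

Set Implicit Arguments.
Unset Strict Implicit.
Unset Printing Implicit Defensive.

Import Order.TTheory GRing.Theory Num.Theory.

Local Open Scope ring_scope.

(** * Sums over tuples with entries in a vertex set *)

Section SequenceSums.
Variables (R : realFieldType) (V : finType).
Implicit Types (W D : {set V}) (f g : seq V -> R) (t : seq V).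

Lemma exists_le_sum (I : finType) (A : {set I}) (F K : I -> R) :
  (0 < #|A|)%N -> \sum_(i in A) F i <= \sum_(i in A) K i ->
  exists2 i, i \in A & F i <= K i.
Proof.
case/card_gt0P=> j Aj leFK; apply/exists_inP; apply: contraTT leFK.
rewrite negb_exists_in -ltNge => /forall_inP ltKF.
by apply: ltr_sum => [|i Ai]; [apply/hasP; exists j; rewrite ?mem_index_enum | rewrite ltNge ltKF].
Qed.

Fixpoint seqsum n W f : R :=
  if n is k.+1 then \sum_(w in W) seqsum k W (fun t => f (w :: t)) else f [::].

Lemma le_seqsum_in n W f g :
    (forall t, size t = n -> all (mem W) t -> f t <= g t) ->
  seqsum n W f <= seqsum n W g.
Proof.
elim: n f g => [|n IHn] f g lefg /=; first exact: lefg.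
apply: ler_sum => w Ww; apply: IHn => t st Wt.
by apply: lefg; rewrite /= ?st ?Wt ?andbT.
Qed.

Lemma le_seqsum n W f g : (forall t, f t <= g t) -> seqsum n W f <= seqsum n W g.
Proof. by move=> lefg; apply: le_seqsum_in. Qed.

Lemma eq_seqsum n W f g : f =1 g -> seqsum n W f = seqsum n W g.
Proof. by move=> fg; apply/le_anti/andP; split; apply: le_seqsum => t; rewrite fg. Qed.

Lemma seqsum_const n W c : seqsum n W (fun=> c) = #|W|%:R ^+ n * c.
Proof.
elim: n => [|n IHn] /=; first by rewrite mul1r.
by rewrite IHn sumr_const -[LHS]mulr_natl mulrA -exprS.
Qed.

Lemma seqsum_ge0 n W f : (forall t, 0 <= f t) -> 0 <= seqsum n W f.
Proof.
by move=> f0; rewrite -(mulr0 (#|W|%:R ^+ n)) -seqsum_const; apply: le_seqsum.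
Qed.

Lemma seqsumD n W f g :
  seqsum n W (fun t => f t + g t) = seqsum n W f + seqsum n W g.
Proof.
elim: n f g => //= n IHn f g; rewrite -big_split.
by apply: eq_bigr => w _; rewrite IHn.
Qed.

Lemma seqsumZ n W c f : seqsum n W (fun t => c * f t) = c * seqsum n W f.
Proof.
elim: n f => //= n IHn f; rewrite mulr_sumr.
by apply: eq_bigr => w _; rewrite IHn.
Qed.

Lemma seqsum_sum (I : finType) (A : {set I}) n W (F : I -> seq V -> R) :
  seqsum n W (fun t => \sum_(i in A) F i t) = \sum_(i in A) seqsum n W (F i).
Proof.
elim: n F => //= n IHn F; rewrite exchange_big.
by apply: eq_bigr => w _; rewrite IHn.
Qed.

Lemma seqsum_exchange n k W D (F : seq V -> seq V -> R) :
  seqsum n W (fun t => seqsum k D (F t)) =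
  seqsum k D (fun u => seqsum n W (F^~ u)).
Proof.
elim: n F => //= n IHn F; rewrite seqsum_sum.
by apply: eq_bigr => w _; rewrite IHn.
Qed.

Lemma seqsum_cat n k W f :
  seqsum (n + k) W f = seqsum n W (fun t => seqsum k W (fun u => f (t ++ u))).
Proof. by elim: n f => //= n IHn f; apply: eq_bigr => w _; rewrite IHn. Qed.

Lemma seqsum_setI n W D f :
  seqsum n (W :&: D) f = seqsum n W (fun t => (all (mem D) t)%:R * f t).
Proof.
elim: n f => [|n IHn] f /=; first by rewrite mul1r.
rewrite big_mkcond [RHS]big_mkcond /=; apply: eq_bigr => w _.
rewrite inE; case: (w \in W) => //=; case: (w \in D) => /=.
  by rewrite IHn.
by rewrite -(mulr0 (#|W|%:R ^+ n)) -seqsum_const; apply: eq_seqsum => t; rewrite mul0r.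
Qed.

Lemma exists_seqsum_ge n W f c :
    (0 < #|W|)%N -> #|W|%:R ^+ n * c <= seqsum n W f ->
  exists t, [/\ size t = n, all (mem W) t & c <= f t].
Proof.
move=> W0; elim: n f => [|n IHn] f /=.
  by rewrite mul1r => le_c; exists [::].
rewrite exprS -mulrA mulr_natl -sumr_const => /(exists_le_sum W0)[w Ww].
by case/IHn=> t [st Wt le_c]; exists (w :: t); rewrite /= st Wt Ww.
Qed.

End SequenceSums.

(** * Power inequalities *)

Section Inequalities.
Variable R : realFieldType.
Implicit Types (s t mu z : R) (k p : nat).

Lemma expr_young k t : 0 <= t -> k.+1%:R * t ^+ k <= k%:R * t ^+ k.+1 + 1.
Proof.
move=> t0; elim: k => [|k IHk]; first by rewrite expr0; lra.
have tk0 : 0 <= t ^+ k by rewrite exprn_ge0.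
(* This is the growth of right side minus left side from [k] to [k + 1]. *)
have : 0 <= k.+1%:R * t ^+ k * (t - 1) ^+ 2.
  by rewrite mulr_ge0 ?sqr_ge0 // mulr_ge0.
rewrite -[k.+2%:R]natr1 -[k.+1%:R]natr1 in IHk *; rewrite !exprS in IHk *.
move: IHk; set c := k%:R; set b := t ^+ k => h1 h2.
nra.
Qed.

(** This is [expr_young] at [mu * s], divided by [(k + 1) * mu ^ k]; the factor [k / (k + 1)] left
    in the first term is bounded by 1. *)
Lemma expr_young_scaled k s mu :
  0 <= s -> 0 < mu -> s ^+ k <= mu * s ^+ k.+1 + mu ^- k / k.+1%:R.
Proof.
move=> s0 mu0; have := expr_young k (mulr_ge0 (ltW mu0) s0).
have muk : 0 < mu ^+ k by rewrite exprn_gt0.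
have k0 : 0 < k.+1%:R :> R by [].
have sk : 0 <= mu * s ^+ k.+1 by rewrite mulr_ge0 ?exprn_ge0 // ltW.
have kk : (k%:R : R) = k.+1%:R - 1 by rewrite -natr1 addrK.
rewrite !exprMn (exprS mu) kk.
move: muk k0 sk; set c := k.+1%:R; set P := mu ^+ k; set B := s ^+ k.+1.
move=> P0 c0 B0 h.
have -> : mu * B + P^-1 / c = (c * P * (mu * B) + 1) / (c * P).
  by field; rewrite !gt_eqF.
rewrite ler_pdivlMr ?mulr_gt0 //; nra.
Qed.

Lemma bernoulli_le p z : 0 <= z <= 1 -> 1 - p%:R * z <= (1 - z) ^+ p.
Proof.
case/andP=> z0 z1; elim: p => [|p IHp]; first by rewrite expr0; lra.
have p0 : 0 <= p%:R :> R by [].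
rewrite exprS -natr1; nra.
Qed.

(** With [u = p / z <= 1 / 2], Bernoulli gives [(1 - 1 / z) ^ p >= 1 - u], and
    [(1 - u) * (1 + 2 * u) >= 1]. *)
Lemma expr_div_pred_le p z :
  0 < z -> p.*2%:R <= z -> 1 < z -> (z - 1) ^- p <= z ^- p * (1 + p.*2%:R / z).
Proof.
move=> z0 pz z1.
have zV1 : 0 <= z^-1 <= 1 by rewrite invr_ge0 ltW //= invf_le1 // ltW.
have := bernoulli_le p zV1.
have -> : 1 - z^-1 = (z - 1) / z by rewrite mulrBl mulfV ?mul1r // gt_eqF.
rewrite expr_div_n => h.
have zp : 0 < z ^+ p by rewrite exprn_gt0.
have z1p : 0 < (z - 1) ^+ p by rewrite exprn_gt0 // subr_gt0.
rewrite -(ler_pM2l z1p) mulfV ?gt_eqF // mulrA.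
have := ler_wpM2r (_ : 0 <= 1 + p.*2%:R / z) h.
move=> H; apply: le_trans (H _); last by rewrite addr_ge0 // divr_ge0 // ltW.
have u0 : 0 <= p%:R / z by rewrite divr_ge0 // ltW.
have u1 : p.*2%:R / z <= 1 by rewrite ler_pdivrMr ?mul1r.
move: u1; rewrite -mul2n natrM -mulrA.
move: u0; set u := _ / _ => u0 u1; nra.
Qed.

End Inequalities.

(** * Common neighbourhoods *)

Definition nbh (G : sgraph) (v : G) : {set G} := [set w | adj v w].

Definition common_nbh (G : sgraph) (t : seq G) : {set G} :=
  [set v | all (adj v) t].

Section CommonNeighbours.
Variable G : sgraph.
Implicit Types (t u : seq G) (C : {set G}).

Lemma card_nbh (v : G) : #|nbh v| = degree v.
Proof. by rewrite cardsE. Qed.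

Lemma common_nbh0 : common_nbh [::] = [set: G].
Proof. by apply/setP=> v; rewrite !inE. Qed.

Lemma common_nbh_cons (w : G) t : common_nbh (w :: t) = nbh w :&: common_nbh t.
Proof. by apply/setP=> v; rewrite !inE /= adj_sym. Qed.

Lemma common_nbh_cat t u : common_nbh (t ++ u) = common_nbh t :&: common_nbh u.
Proof. by apply/setP=> v; rewrite !inE all_cat. Qed.

(** This symmetry drives the double counting in dependent random choice. *)
Lemma all_common_nbhC t u : all (mem (common_nbh u)) t = all (mem (common_nbh t)) u.
Proof.
apply/allP/allP => h v vin; rewrite /= inE; apply/allP => w win.
  by have := h w win; rewrite /= inE => /allP/(_ v vin); rewrite adj_sym.
by have := h w win; rewrite /= inE => /allP/(_ v vin); rewrite adj_sym.
Qed.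

End CommonNeighbours.

(** * Moments measuring the scarcity of candidates *)

Section Potential.
Variables (R : realFieldType) (G : sgraph) (M : R) (a : nat).
Hypothesis M_gt0 : 0 < M.
Hypothesis a_gt0 : (0 < a)%N.
Implicit Types (W C D : {set G}) (i l : nat).

(* The shift by [a] keeps the removal of one vertex from [C] a small relative
   change, even when [C] is small or empty. *)
Definition scarcity l C : R := (M / (#|C| + a)%:R) ^+ l.*2.

Definition mean_scarcity W i l C : R :=
  #|W|%:R ^- i * seqsum i W (fun t => scarcity l (C :&: common_nbh t)).

Lemma scarcity_ge0 l C : 0 <= scarcity l C.
Proof. by rewrite exprn_ge0 // divr_ge0 // ltW. Qed.

Lemma mean_scarcity_ge0 W i l C : 0 <= mean_scarcity W i l C.
Proof.
by rewrite mulr_ge0 ?invr_ge0 ?exprn_ge0 // seqsum_ge0 // => t; apply: scarcity_ge0.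
Qed.

Lemma mean_scarcity0 W l C : mean_scarcity W 0 l C = scarcity l C.
Proof. by rewrite /mean_scarcity /= expr0 invr1 mul1r common_nbh0 setIT. Qed.

Lemma mean_scarcityS W i l C :
  mean_scarcity W i.+1 l C =
  #|W|%:R^-1 * \sum_(w in W) mean_scarcity W i l (C :&: nbh w).
Proof.
rewrite /mean_scarcity -mulr_sumr mulrA -invfM -exprS /=; congr (_ * _).
apply: eq_bigr => w _; apply: eq_seqsum => t.
by rewrite common_nbh_cons setIA.
Qed.

Lemma le_scarcity l C D : D \subset C -> scarcity l C <= scarcity l D.
Proof.
move=> sDC; rewrite lerXn2r ?nnegrE ?divr_ge0 ?(ltW M_gt0) //.
rewrite ler_pM2l // lef_pV2 ?posrE ?ltr0n ?addn_gt0 ?a_gt0 ?orbT //.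
by rewrite ler_nat leq_add2r subset_leq_card.
Qed.

Lemma le_mean_scarcity W i l C D :
  D \subset C -> mean_scarcity W i l C <= mean_scarcity W i l D.
Proof.
move=> sDC; rewrite ler_wpM2l ?invr_ge0 ?exprn_ge0 //.
by apply: le_seqsum => t; rewrite le_scarcity // setSI.
Qed.

Lemma mean_scarcity_leS W i l C :
  (0 < #|W|)%N -> mean_scarcity W i l C <= mean_scarcity W i.+1 l C.
Proof.
move=> W0; have WR : 0 < #|W|%:R :> R by rewrite ltr0n.
rewrite mean_scarcityS -(ler_pM2l WR) mulVKf ?gt_eqF // mulr_natl -sumr_const.
by apply: ler_sum => w _; apply: le_mean_scarcity; rewrite subsetIl.
Qed.

Lemma mean_scarcity_le W i j l k C :
    (0 < #|W|)%N -> (i <= j)%N -> (l <= k)%N -> (#|G| + a)%:R <= M ->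
  mean_scarcity W i l C <= mean_scarcity W j k C.
Proof.
move=> W0 /subnKC<- lek GM; apply: (@le_trans _ _ (mean_scarcity W i k C)).
  rewrite ler_wpM2l ?invr_ge0 ?exprn_ge0 //.
  apply: le_seqsum => t; rewrite ler_weXn2l ?leq_double //.
  rewrite ler_pdivlMr ?ltr0n ?addn_gt0 ?a_gt0 ?orbT // mul1r.
  by rewrite (le_trans _ GM) // ler_nat leq_add2r max_card.
elim: (j - i)%N => [|e IHe]; first by rewrite addn0.
by rewrite addnS (le_trans IHe) // mean_scarcity_leS.
Qed.

Lemma mean_scarcity_young W i l C (mu : R) : 0 < mu ->
  mean_scarcity W i l C <=
  mu * mean_scarcity W i l.+1 C + mu ^- l / l.+1%:R.
Proof.
move=> mu0; have Wi0 : 0 <= #|W|%:R ^+ i :> R by rewrite exprn_ge0.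
have c0 : 0 <= mu ^- l / l.+1%:R by rewrite divr_ge0 // invr_ge0 exprn_ge0 // ltW.
pose f l t := scarcity l (C :&: common_nbh t).
apply: (@le_trans _ _ (#|W|%:R ^- i *
    seqsum i W (fun t => mu * f l.+1 t + mu ^- l / l.+1%:R))).
  rewrite ler_wpM2l ?invr_ge0 //; apply: le_seqsum => t.
  (* The exponent [2 * l] is read as the [l]-th power of a square, so passing from [l] to [l + 1]
     trades two powers of the ratio. *)
  rewrite /f /scarcity -!mul2n !exprM.
  by apply: expr_young_scaled => //; rewrite sqr_ge0.
rewrite seqsumD seqsumZ seqsum_const mulrDr mulrCA lerD2l mulrA.
have [->|Wi1] := eqVneq (#|W|%:R ^+ i) (0 : R); first by rewrite mulr0 mul0r.
by rewrite mulVf // mul1r.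
Qed.

(* Restricting the average from [W] to a small [X] costs a factor [#|W| / #|X|];
   lowering the exponent by one turns this factor into an additive term. *)
Lemma sum_mean_scarcity_nbh W (X : {set G}) i l C (mu : R) :
    0 < mu -> X \subset W ->
  \sum_(w in X) mean_scarcity W i l (C :&: nbh w) <=
  mu * (#|W|%:R * mean_scarcity W i.+1 l.+1 C) + #|X|%:R * (mu ^- l / l.+1%:R).
Proof.
move=> mu0 sXW; rewrite [X in _ <= _ + X]mulr_natl -[X in _ <= _ + X]sumr_const.
apply: (le_trans (ler_sum _ (fun w _ => mean_scarcity_young W i l (C :&: nbh w) mu0))).
rewrite big_split /= lerD2r -mulr_sumr ler_wpM2l ?(ltW mu0) //.
rewrite mean_scarcityS.
apply: (@le_trans _ _ (\sum_(w in W) mean_scarcity W i l.+1 (C :&: nbh w))).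
  rewrite [X in _ <= X](big_setID X) /= (setIidPr sXW) lerDl.
  by apply: sumr_ge0 => w _; apply: mean_scarcity_ge0.
have [W0|W0] := eqVneq #|W|%:R (0 : R); last by rewrite mulVKf.
move/eqP: W0; rewrite pnatr_eq0 cards_eq0 => /eqP->.
by rewrite !big_set0 !mulr0.
Qed.

(** Only a [w] in [C] matters. Its removal multiplies the scarcity by at most
    [1 + 4 * l / (#|C| + a)], and there are at most [#|C|] such [w], so the total excess is at most
    [4 * l] times the scarcity. *)
Lemma sum_scarcity_setD1 (X C : {set G}) l :
    (l.*2.*2 <= a)%N ->
  \sum_(w in X) scarcity l (C :\ w) <= (#|X| + l.*2.*2)%:R * scarcity l C.
Proof.
move=> la; set g := scarcity l C; have g0 : 0 <= g by apply: scarcity_ge0.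
pose e : R := l.*2.*2%:R / (#|C| + a)%:R.
have e0 : 0 <= e by rewrite divr_ge0.
have step w : scarcity l (C :\ w) <= g + (w \in C)%:R * (g * e).
  have [Cw|Cw] := boolP (w \in C); last first.
    by rewrite mul0r addr0 /g; have /setDidPl-> : [disjoint C & [set w]] by rewrite disjoint_sym disjoints1.
  rewrite mul1r -[X in X + _]mulr1 -mulrDr /g /scarcity !expr_div_n -mulrA ler_pM2l ?exprn_gt0 //.
  have C0 : (0 < #|C|)%N by apply/card_gt0P; exists w.
  have -> : (#|C :\ w| + a)%:R = (#|C| + a)%:R - 1 :> R.
    by rewrite [in RHS](cardsD1 w) Cw add1n addSn -natr1 addrK.
  apply: expr_div_pred_le; rewrite ?ltr0n ?ler_nat ?ltr1n; lia.
apply: (le_trans (ler_sum _ (fun w _ => step w))).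
rewrite big_split /= sumr_const -[g *+ _]mulr_natl natrD mulrDl lerD2l -mulr_suml.
rewrite mulrCA mulrC ler_wpM2r //.
apply: (@le_trans _ _ (#|C|%:R * e)).
  rewrite ler_wpM2r // -natr_sum ler_nat -sum1_card big_mkcond [X in (_ <= X)%N]big_mkcond /=.
  by apply: leq_sum => w _; case: (w \in X) (w \in C) => [] [].
rewrite /e mulrCA -[X in _ <= X]mulr1 ler_wpM2l //.
by rewrite ler_pdivrMr ?ltr0n ?addn_gt0 ?a_gt0 ?orbT // mul1r ler_nat leq_addr.
Qed.

Lemma sum_mean_scarcity_setD1 W (X C : {set G}) i l :
    (l.*2.*2 <= a)%N ->
  \sum_(w in X) mean_scarcity W i l (C :\ w) <=
  (#|X| + l.*2.*2)%:R * mean_scarcity W i l C.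
Proof.
move=> la; rewrite -mulr_sumr mulrCA ler_wpM2l ?invr_ge0 ?exprn_ge0 //.
rewrite -seqsum_sum -seqsumZ; apply: le_seqsum => t.
apply: le_trans (sum_scarcity_setD1 _ _ la).
by apply/ler_sum => w _; rewrite setIDAC.
Qed.

End Potential.

(** * Degenerate orders and their weights *)

Definition induced_subgraph (G : sgraph) (D : {set G}) : sgraph :=
  @SGraph {x : G | x \in D} (fun u v => adj (val u) (val v))
    (fun u v => adj_sym (val u) (val v)) (fun u => adj_irrefl (val u)).

Lemma induced_is_subgraph (G : sgraph) (D : {set G}) :
  is_subgraph (induced_subgraph D) G.
Proof. by exists val => //; apply: val_inj. Qed.

Section VertexOrder.
Variable H : sgraph.
Implicit Types (s : seq H) (u v x : H) (D : {set H}).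

(** In the embedding, [s] lists the vertices still to be placed, head first; for [u] in [s] only the
    neighbours whose images are still open are counted. *)
Fixpoint back_degree s u : nat :=
  if s is x :: s' then if u == x then 0%N else (adj x u + back_degree s' u)%N
  else 0%N.

Lemma back_degree_rcons s v u : u \in s -> back_degree (rcons s v) u = back_degree s u.
Proof.
by elim: s => //= x s IHs; rewrite inE; case: eqP => //= _ /IHs->.
Qed.

Lemma back_degree_rcons_last s v :
  v \notin s -> back_degree (rcons s v) v = count (adj v) s.
Proof.
elim: s => [|x s IHs] /=; first by rewrite eqxx.
by rewrite inE negb_or => /andP[/negPf-> /IHs->]; rewrite adj_sym.
Qed.

(** Built from the end: a vertex of degree at most [d] in the graph induced on [D] goes last, and
    the rest of [D] is ordered by induction. *)
Lemma degenerate_order d : degenerate d H ->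
  exists s, [/\ uniq s, forall u, u \in s & forall u, (back_degree s u <= d)%N].
Proof.
move=> degH.
suff order_set n D : #|D| = n -> exists s,
    [/\ uniq s, s =i D & forall u, u \in s -> (back_degree s u <= d)%N].
  have [s [us sT sd]] := order_set _ [set: H] erefl.
  have s_all u : u \in s by rewrite sT inE.
  by exists s; split=> // u; apply: sd.
elim: n D => [|n IHn] D cD.
  by exists [::]; split=> // u; move/eqP: cD; rewrite cards_eq0 => /eqP->; rewrite inE.
have [|[v Dv] deg_v] := degH _ (induced_is_subgraph D).
  by rewrite /= card_sig -(eq_card (fun _ => erefl : _ \in D = _)) cD.
have [|s [us sD sd]] := IHn (D :\ v); first by move: cD; rewrite (cardsD1 v) Dv => -[].
have vs : v \notin s by rewrite sD !inE eqxx.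
exists (rcons s v); split; first by rewrite rcons_uniq vs.
  by move=> u; rewrite mem_rcons inE sD !inE; case: eqP => // ->.
move=> u; rewrite mem_rcons inE => /orP[/eqP->|su]; last by rewrite back_degree_rcons // sd.
rewrite back_degree_rcons_last // (leq_trans _ deg_v) // -size_filter.
rewrite /degree -(card_imset _ val_inj) /=.
have uf : uniq [seq w <- s | adj v w] by rewrite filter_uniq.
rewrite -(card_uniqP uf); apply/subset_leq_card/subsetP => w.
rewrite mem_filter sD !inE => /and3P[vw _ Dw].
by apply/imsetP; exists (Sub w Dw : {x | x \in D}).
Qed.

Variables (R : realFieldType) (c : R).
Hypothesis c_ge0 : 0 <= c.

Fixpoint order_weight s : H -> R :=
  if s is x :: s' then
    fun u => if u == x then 1 + c * \sum_(v <- s' | adj x v) order_weight s' v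
             else order_weight s' u
  else fun=> 0.

Lemma order_weight_ge0 s u : 0 <= order_weight s u.
Proof.
elim: s u => //= x s IHs u; case: eqP => // _.
by rewrite addr_ge0 // mulr_ge0 // sumr_ge0.
Qed.

Lemma order_weight_ge1 s u : u \in s -> 1 <= order_weight s u.
Proof.
elim: s => //= x s IHs; rewrite inE; case: eqP => //= _ _.
by rewrite lerDl mulr_ge0 // sumr_ge0 // => v _; apply: order_weight_ge0.
Qed.

Lemma order_weight_head x s :
  order_weight (x :: s) x = 1 + c * \sum_(v <- s | adj x v) order_weight s v.
Proof. by rewrite /= eqxx. Qed.

Lemma order_weight_tail x s u :
  x \notin s -> u \in s -> order_weight (x :: s) u = order_weight s u.
Proof. by move=> xs us /=; case: eqP us xs => // -> ->. Qed.

Lemma back_degree_head x s : back_degree (x :: s) x = 0%N.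
Proof. by rewrite /= eqxx. Qed.

Lemma back_degree_tail x s u :
  x \notin s -> u \in s -> back_degree (x :: s) u = (adj x u + back_degree s u)%N.
Proof. by move=> xs us /=; case: eqP us xs => // -> ->. Qed.

(** Each [u] adds [c] times its weight to the weight of every earlier neighbour; subtracting these
    contributions leaves 1 per vertex. *)
Lemma sum_order_weight s : uniq s ->
  \sum_(u <- s) order_weight s u * (1 - c * (back_degree s u)%:R) = (size s)%:R.
Proof.
elim: s => [|x s IHs]; first by rewrite big_nil.
case/andP=> xs us; rewrite big_cons back_degree_head order_weight_head mulr0 subr0 mulr1.
rewrite -[size _]/(size s).+1 -natr1 -(IHs us) -addrA [RHS]addrC; congr (1 + _).
rewrite [X in c * X + _]big_mkcond mulr_sumr 2!big_seq [in RHS]big_seq.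
rewrite -big_split; apply: eq_bigr => u su.
rewrite back_degree_tail // order_weight_tail // natrD.
by case: (adj x u) => /=; ring.
Qed.

End VertexOrder.

(** * Embedding one vertex at a time *)

Definition restrict_candidates (H G : sgraph) (x : H) (w : G) (C : H -> {set G}) :
    H -> {set G} :=
  fun u => if adj x u then C u :&: nbh w else C u :\ w.

Lemma embedding_of_invariant (H G : sgraph) (w0 : G)
    (inv : seq H -> (H -> {set G}) -> Prop) :
    (forall x s C, uniq (x :: s) -> inv (x :: s) C ->
       exists2 w, w \in C x & inv s (restrict_candidates x w C)) ->
  forall s C, uniq s -> inv s C -> exists phi : H -> G,
    [/\ {in s &, injective phi}, {in s, forall u, phi u \in C u}
      & {in s &, forall u v, adj u v -> adj (phi u) (phi v)}].
Proof.
move=> step; elim=> [|x s IHs] C; first by exists (fun=> w0).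
move=> uxs; have /andP[xs us] := uxs.
case/(step _ _ _ uxs)=> w Cw /(IHs _ us)[phi [inj_phi phiC phi_adj]].
(* Neighbours of [x] lose the candidate [w] too, since [w] is not adjacent to itself. *)
have C_sub u : u \in s -> (phi u \in C u) && (phi u != w).
  move/phiC; rewrite /restrict_candidates; case: ifP => _; rewrite !inE.
    by case/andP=> -> wu; apply: contraTneq wu => ->; rewrite adj_irrefl.
  by rewrite andbC.
have adj_x u : u \in s -> adj x u -> adj w (phi u).
  by move/phiC; rewrite /restrict_candidates => + xu; rewrite xu !inE => /andP[].
have neq_x u : u \in s -> (u == x) = false.
  by move=> su; apply: contraNF xs => /eqP<-.
exists (fun u => if u == x then w else phi u); split.
- move=> u v; rewrite !inE; have [->|_] := eqVneq u x; have [->|_] := eqVneq v x => //=.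
  + by move=> _ /C_sub/andP[_ /eqP nw] /esym.
  + by move=> /C_sub/andP[_ /eqP nw].
  + exact: inj_phi.
- move=> u; rewrite inE; have [->|_ /= /C_sub/andP[]] := eqVneq u x => //.
- move=> u v; rewrite !inE; have [->|_] := eqVneq u x; have [->|_] := eqVneq v x => //=.
  + by rewrite adj_irrefl.
  + by move=> _; apply: adj_x.
  + by move=> su _; rewrite adj_sym => /(adj_x _ su); rewrite adj_sym.
  + exact: phi_adj.
Qed.

(** * Embedding controlled by the total cost *)

Section PotentialEmbedding.
Variables (R : realFieldType) (H G : sgraph) (side : H -> bool) (V : bool -> {set G}).
Variables (d : nat) (Q M N : R).
Hypothesis side_adj : forall u v : H, adj u v -> side u != side v.
Hypothesis d_gt0 : (0 < d)%N.
Hypothesis Q_ge1 : 1 <= Q.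
Hypothesis N_ge1 : 1 <= N.
Hypothesis V_small : forall b, 2 * #|V b|%:R <= M.
Hypothesis M_large : (24 * d)%:R * N <= Q ^- (2 * d) * M.
Implicit Types (s : seq H) (u v x : H) (C : H -> {set G}).

(** The deletion bound needs [4 * l <= a], and [l = 2 * d + i] is at most [3 * d]. *)
Let a := (12 * d)%N.

(* Chosen so that [(threshold i.+1 / threshold i) ^+ (2 * d + i) / threshold i]
   is at most [(Q ^- (2 * d)) ^+ (2 * d + i)]. *)
Definition threshold i : R := Q ^+ ((2 * d + i) * (4 * d - i)).

(** The moment has exponent [2 * (2 * d + i)] at back degree [i], so it drops by 2 with each placed
    neighbour. The summand 1 lets the cost of the head, [1 + t ^ (4 * d)], dominate all lower powers
    of [t]. *)
Definition vertex_cost s C u : R :=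
  1 + mean_scarcity M a (V (~~ side u)) (back_degree s u)
        (2 * d + back_degree s u) (C u) / threshold (back_degree s u).

Definition total_cost s C : R :=
  \sum_(u <- s) order_weight (2 * d)%:R^-1 s u * vertex_cost s C u.

Definition cost_invariant s C : Prop :=
  [/\ {in s, forall u, back_degree s u <= d}%N,
      {in s, forall u, C u \subset V (side u)} & total_cost s C <= N].

Let Q_gt0 : 0 < Q. Proof. exact: lt_le_trans Q_ge1. Qed.

Let a_gt0 : (0 < a)%N. Proof. by rewrite /a muln_gt0. Qed.

Let M_gt0 : 0 < M.
Proof.
rewrite -(@pmulr_rgt0 _ (Q ^- (2 * d))) ?invr_gt0 ?exprn_gt0 //.
apply: lt_le_trans M_large; rewrite mulr_gt0 ?ltr0n ?muln_gt0 //.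
exact: lt_le_trans N_ge1.
Qed.

Let weight_ge0 : 0 <= (2 * d)%:R^-1 :> R. Proof. by rewrite invr_ge0. Qed.

Let threshold_gt0 i : 0 < threshold i. Proof. exact: exprn_gt0. Qed.

Lemma vertex_cost_ge1 s C u : 1 <= vertex_cost s C u.
Proof. by rewrite lerDl divr_ge0 ?mean_scarcity_ge0 // ltW. Qed.

Let vertex_cost_ge0 s C u : 0 <= vertex_cost s C u.
Proof. exact: le_trans (vertex_cost_ge1 s C u). Qed.

Lemma vertex_cost_head x s C :
  vertex_cost (x :: s) C x = 1 + (Q ^- (2 * d) * M / (#|C x| + a)%:R) ^+ (4 * d).
Proof.
rewrite /vertex_cost back_degree_head mean_scarcity0 /scarcity /threshold.
congr (_ + _); rewrite addn0 subn0 -[_ * M / _]mulrA [RHS]exprMn mulrC.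
by rewrite exprVn -exprM; congr (_ * _ ^+ _); lia.
Qed.

Lemma thresholdS i : (i < d)%N -> threshold i.+1 = Q ^+ (2 * d - i.*2.+1) * threshold i.
Proof. by move=> id; rewrite /threshold -exprD; congr (_ ^+ _); lia. Qed.

(** Young's inequality splits the sum into a multiple of the old moment and a constant. The constant
    is at most [t ^ l / (l + 1)] per candidate, where [1 + t ^ (4 * d)] is the cost of [x]; now
    [l <= 4 * d] and [2 * d <= l + 1]. *)
Lemma sum_vertex_cost_adj x s C u :
    x \notin s -> u \in s -> adj x u -> (back_degree (x :: s) u <= d)%N ->
    C x \subset V (side x) -> (a <= #|C x|)%N ->
  \sum_(w in C x) vertex_cost s (restrict_candidates x w C) u <=
  #|C x|%:R * (vertex_cost (x :: s) C u + (2 * d)%:R^-1 * vertex_cost (x :: s) C x).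
Proof.
move=> xs us xu; rewrite vertex_cost_head /vertex_cost /restrict_candidates xu.
rewrite back_degree_tail // xu add1n.
have -> : ~~ side u = side x by have := side_adj xu; case: (side x) (side u) => [] [].
set i := back_degree s u; set W := V (side x) => id CW aC.
set X := C x; set n := (#|X| + a)%:R : R; set l := (2 * d + i)%N.
have n0 : 0 < n by rewrite ltr0n addn_gt0 a_gt0 orbT.
have X0 : 0 <= #|X|%:R :> R by [].
rewrite big_split /= sumr_const -mulr_suml -mulr_natr mul1r -addrA mulrDr mulr1 lerD2l.
(* This [mu] rescales the old moment to its new threshold; the factor [n * #|W| / M] that remains is
   at most [#|X|], as [n <= 2 * #|X|] and [2 * #|W| <= M]. *)
pose mu := threshold i / threshold i.+1 * (n / M).
have mu0 : 0 < mu by rewrite mulr_gt0 ?divr_gt0 ?threshold_gt0 ?M_gt0.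
rewrite ler_pdivrMr //.
apply: (le_trans (sum_mean_scarcity_nbh a M_gt0 i l (C u) mu0 CW)).
rewrite mulrDr mulrDl addnS lerD //.
  set P := mean_scarcity _ _ _ _ _ _; have P0 : 0 <= P by apply: mean_scarcity_ge0.
  rewrite /mu; move: (threshold_gt0 i) (threshold_gt0 i.+1).
  set p := threshold i; set q := threshold i.+1 => p0 q0.
  have -> : p / q * (n / M) * (#|W|%:R * P) = p * P / q * (n * #|W|%:R / M).
    by field; rewrite !gt_eqF.
  have -> : #|X|%:R * (P / q) * p = p * P / q * #|X|%:R.
    by field; rewrite !gt_eqF.
  have pq0 : 0 <= p * P / q by exact: divr_ge0 (mulr_ge0 (ltW p0) P0) (ltW q0).
  apply: ler_wpM2l => //; rewrite ler_pdivrMr //.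
  have nX : n <= 2 * #|X|%:R by rewrite -natrM ler_nat mul2n -addnn leq_add2l.
  have := V_small (side x); rewrite -/W; move=> WM.
  apply: (le_trans (ler_wpM2r (ler0n _ #|W|) nX)).
  by rewrite [2 * _]mulrC -mulrA ler_wpM2l.
rewrite -[X in _ <= X]mulrA ler_wpM2l //; set t := _ / n.
have t0 : 0 <= t by rewrite /t !mulr_ge0 ?invr_ge0 ?exprn_ge0 ?ltW.
have l4 : (l <= 4 * d)%N by rewrite /l; move: id; clear; lia.
have l2 : (2 * d <= l.+1)%N by rewrite /l; clear; lia.
have tl : t ^+ l <= 1 + t ^+ (4 * d).
  have [t1|/ltW t1] := lerP t 1; first by rewrite (le_trans (exprn_ile1 _ t0 t1)) // lerDl exprn_ge0.
  by rewrite (le_trans (ler_weXn2l t1 l4)) ?lerDr.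
have mul : mu ^- l <= t ^+ l * threshold i.
  have mu_inv : mu^-1 = Q ^+ (2 * d - i.*2.+1) * (M / n).
    rewrite /mu thresholdS //; move: (threshold_gt0 i).
    have : 0 < Q ^+ (2 * d - i.*2.+1) by rewrite exprn_gt0.
    set p := threshold i; set q := Q ^+ _ => q0 p0; field.
    by rewrite -natrD !gt_eqF.
  have Mn0 : 0 <= M / n by rewrite divr_ge0 // ltW.
  have tE : t = Q ^- (2 * d) * (M / n) by rewrite /t mulrA.
  rewrite -exprVn mu_inv tE; move: (M / n) Mn0 => r r0.
  rewrite !exprMn mulrAC; apply: ler_wpM2r; first exact: exprn_ge0.
  rewrite exprVn mulrC ler_pdivlMr ?exprn_gt0 // -!exprM -exprD ler_weXn2l //.
  by rewrite /l; move: id; clear; nia.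
rewrite ler_pdivrMr // (le_trans mul) // [X in _ <= X]mulrAC.
apply: ler_wpM2r; first exact: ltW.
rewrite -mulrA ler_pdivlMl ?ltr0n ?muln_gt0 //.
by rewrite mulrC; apply: ler_pM; rewrite ?exprn_ge0 ?ler_nat.
Qed.

Lemma sum_vertex_cost_nonadj x s C u :
    x \notin s -> u \in s -> ~~ adj x u -> (back_degree (x :: s) u <= d)%N ->
  \sum_(w in C x) vertex_cost s (restrict_candidates x w C) u <=
  (#|C x| + a)%:R * vertex_cost (x :: s) C u.
Proof.
move=> xs us /negPf xu; rewrite /vertex_cost /restrict_candidates xu.
rewrite back_degree_tail // xu add0n; set i := back_degree s u => id.
have la : ((2 * d + i).*2.*2 <= a)%N by rewrite /a; move: id; clear; lia.
rewrite big_split /= sumr_const -mulr_suml mulrDr mulr1 lerD ?ler_nat ?leq_addr //.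
rewrite mulrA ler_wpM2r ?invr_ge0 ?(ltW (threshold_gt0 i)) //.
apply: (le_trans (sum_mean_scarcity_setD1 M_gt0 a_gt0 _ _ _ _ la)).
by rewrite ler_wpM2r ?mean_scarcity_ge0 // ler_nat leq_add2l.
Qed.

Lemma vertex_cost_le_total x s C :
  vertex_cost (x :: s) C x <= total_cost (x :: s) C.
Proof.
rewrite /total_cost big_cons -[X in X <= _]addr0 lerD ?sumr_ge0 // => [|u _].
  by rewrite ler_peMl // order_weight_ge1 // inE eqxx.
by rewrite mulr_ge0 ?order_weight_ge0.
Qed.

(** Averaged over the candidates [w], the new total is at most [(1 + a / #|X|) * (T - h)]. This is
    at most [T] because [a * T <= a * N <= h * #|X|]. *)
Lemma cost_invariant_step x s C : uniq (x :: s) -> cost_invariant (x :: s) C ->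
  exists2 w, w \in C x & cost_invariant s (restrict_candidates x w C).
Proof.
move=> /andP[xs us] [deg_s CV costN].
have xin : x \in x :: s by rewrite inE eqxx.
have sin u : u \in s -> u \in x :: s by rewrite inE => ->; rewrite orbT.
set X := C x; set h := vertex_cost (x :: s) C x.
have hN : h <= N := le_trans (vertex_cost_le_total x s C) costN.
set t := Q ^- (2 * d) * M / (#|X| + a)%:R.
have hE : h = 1 + t ^+ (4 * d) := vertex_cost_head x s C.
have n0 : 0 < (#|X| + a)%:R :> R by rewrite ltr0n addn_gt0 a_gt0 orbT.
have t0 : 0 <= t by rewrite /t !mulr_ge0 ?invr_ge0 ?exprn_ge0 ?ltW.
have th : t <= h.
  rewrite hE; have [t1|/ltW t1] := lerP t 1.
    by rewrite (le_trans t1) // lerDl exprn_ge0.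
  by rewrite -{1}[t]expr1 (le_trans (ler_weXn2l t1 (_ : (1 <= 4 * d)%N))) ?lerDr // muln_gt0.
(* With fewer than [a] candidates the denominator of [t] would be below [24 * d], so [t > N] by
   [M_large], against [t <= h <= N]. *)
have aX : (a <= #|X|)%N.
  rewrite leqNgt; apply/negP => Xa.
  suff : N < t by rewrite ltNge (le_trans th).
  rewrite /t ltr_pdivlMr // (lt_le_trans _ M_large) // mulrC ltr_pM2r ?(lt_le_trans ltr01) //.
  by rewrite ltr_nat; move: Xa; rewrite /a; clear; lia.
have X0 : (0 < #|X|)%N by apply: leq_trans aX.
pose T := total_cost (x :: s) C.
have sumT : \sum_(w in X) total_cost s (restrict_candidates x w C) <=
    (#|X| + a)%:R * (T - h).
  rewrite /T /total_cost big_cons order_weight_head -/h exchange_big.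
  set S := \sum_(u <- s | adj x u) _.
  (* The excess of the weight of [x] over 1 pays exactly for the additive terms [h / (2 * d)] at its
     later neighbours. *)
  have -> : (1 + (2 * d)%:R^-1 * S) * h + \sum_(u <- s)
        order_weight (2 * d)%:R^-1 (x :: s) u * vertex_cost (x :: s) C u - h =
      \sum_(u <- s) order_weight (2 * d)%:R^-1 s u *
        (vertex_cost (x :: s) C u + (adj x u)%:R * ((2 * d)%:R^-1 * h)).
    rewrite (eq_big_seq (fun u => order_weight (2 * d)%:R^-1 s u *
      vertex_cost (x :: s) C u)) => [|u su]; last by rewrite order_weight_tail.
    under [RHS]eq_bigr do rewrite mulrDr.
    rewrite big_split /=.
    have -> : \sum_(u <- s) order_weight (2 * d)%:R^-1 s u *
        ((adj x u)%:R * ((2 * d)%:R^-1 * h)) = S * ((2 * d)%:R^-1 * h).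
      rewrite mulr_suml [RHS]big_mkcond; apply: eq_bigr => u _.
      by case: (adj x u); rewrite (mul0r, mul1r) ?mulr0.
    by ring.
  rewrite mulr_sumr big_seq [X in _ <= X]big_seq; apply: ler_sum => u su.
  rewrite -mulr_sumr mulrCA ler_wpM2l ?order_weight_ge0 //.
  case xu: (adj x u); last first.
    by rewrite mul0r addr0 sum_vertex_cost_nonadj ?xu // deg_s // sin.
  rewrite mul1r.
  apply: (le_trans (sum_vertex_cost_adj (C := C) xs su xu (deg_s u (sin u su))
    (CV x xin) aX)).
  by apply: ler_wpM2r; [rewrite addr_ge0 ?mulr_ge0 | rewrite ler_nat leq_addr].
have [w Xw costw] : exists2 w, w \in X & total_cost s (restrict_candidates x w C) <= T.
  apply: exists_le_sum => //; apply: (le_trans sumT).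
  rewrite sumr_const -mulr_natl natrD.
  have aR : a%:R * N <= h * #|X|%:R.
    apply: (@le_trans _ _ (t * #|X|%:R)); last by rewrite ler_wpM2r.
    rewrite /t mulrAC ler_pdivlMr //.
    have nX : (#|X| + a)%:R <= 2 * #|X|%:R :> R.
      by rewrite -natrM ler_nat mul2n -addnn leq_add2l.
    have a0 : 0 <= a%:R * N by rewrite mulr_ge0 // (le_trans ler01).
    apply: (le_trans (ler_wpM2l a0 nX)).
    rewrite mulrCA mulrA ler_wpM2r // mulrA (le_trans _ M_large) // -natrM.
    by rewrite [(2 * a)%N](_ : _ = 24 * d)%N // /a; clear; lia.
  have h0 : 0 <= h by apply: vertex_cost_ge0.
  have a0 : 0 <= a%:R :> R by [].
  have T0 : T <= N by [].
  nra.
exists w => //; split; last exact: le_trans costw costN.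
  move=> u su; apply: leq_trans (deg_s u (sin u su)).
  by rewrite back_degree_tail // leq_addl.
move=> u su; apply: subset_trans (CV u (sin u su)); rewrite /restrict_candidates.
by case: ifP => _; rewrite ?subsetIl ?subsetDl.
Qed.

End PotentialEmbedding.

Lemma subgraph_of_mean_scarcity (R : realFieldType) (H G : sgraph) (side : H -> bool)
    (V : bool -> {set G}) (d : nat) (Q M : R) :
    (forall u v : H, adj u v -> side u != side v) -> degenerate d H ->
    (0 < d)%N -> (0 < #|H|)%N -> 1 <= Q ->
    (forall b, 0 < #|V b|)%N -> (forall b, 2 * #|V b|%:R <= M) ->
    (#|G| + 12 * d)%:R <= M ->
    (96 * d * #|H|)%:R <= Q ^- (2 * d) * M ->
    (forall b, mean_scarcity M (12 * d) (V (~~ b)) d (3 * d) (V b) <= Q ^+ (8 * d ^ 2)) ->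
  is_subgraph H G.
Proof.
move=> side_adj degH d0 H0 Q1 V0 VM GM HM scar.
have [s [us s_all deg_s]] := degenerate_order degH.
have size_s : size s = #|H|.
  by rewrite -(card_uniqP us); apply: eq_card => u; rewrite s_all inE.
(* The initial costs are at most 2 each, and the weights add up to at most [2 * #|H|]. *)
pose N : R := (4 * #|H|)%:R.
have N1 : 1 <= N by rewrite ler1n muln_gt0.
have HM' : (24 * d)%:R * N <= Q ^- (2 * d) * M.
  by rewrite -natrM (le_trans _ HM) // ler_nat; clear; lia.
have a0 : (0 < 12 * d)%N by rewrite muln_gt0.
have M0 : 0 < M by apply: lt_le_trans GM; rewrite ltr0n addn_gt0 a0 orbT.
have /card_gt0P[w0 _] := V0 true.
pose C u := V (side u).
have cost2 u : vertex_cost side V d Q M s C u <= 2.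
  have thr0 i : 0 < threshold d Q i by rewrite exprn_gt0 // (lt_le_trans ltr01).
  rewrite -[2]/(1 + 1) lerD2l ler_pdivrMr // mul1r.
  set i := back_degree s u; have id : (i <= d)%N := deg_s u.
  (* The exponent of [threshold i] exceeds [8 * d ^ 2] by [i * (2 * d - i) >= 0]. *)
  apply: (@le_trans _ _ (Q ^+ (8 * d ^ 2))); last first.
    by rewrite ler_weXn2l //; move: id; clear; nia.
  apply: le_trans (scar (side u)); apply: mean_scarcity_le => //.
  by move: id; clear; lia.
pose c : R := (2 * d)%:R^-1.
have c0 : 0 <= c by rewrite invr_ge0.
have weight2 : \sum_(u <- s) order_weight c s u <= 2 * (size s)%:R.
  rewrite -(sum_order_weight c us) mulr_sumr; apply: ler_sum => u _.
  rewrite mulrCA ler_peMr ?order_weight_ge0 // mulrBr mulr1.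
  have : c * (back_degree s u)%:R <= 2^-1.
    rewrite /c natrM invfM -mulrA ger_pMr // ler_pdivrMl ?ltr0n // mulr1.
    by rewrite ler_nat.
  lra.
have inv0 : cost_invariant side V d Q M N s C.
  split=> //.
  apply: (@le_trans _ _ (\sum_(u <- s) order_weight c s u * 2)).
    by apply: ler_sum => u _; rewrite ler_wpM2l ?order_weight_ge0.
  rewrite -mulr_suml /N natrM -size_s; move: weight2; lra.
have step := cost_invariant_step side_adj d0 Q1 N1 VM HM'.
have [phi [inj_phi _ phi_adj]] := embedding_of_invariant w0 step us inv0.
by exists phi => [u v|u v]; [apply: inj_phi | apply: phi_adj].
Qed.

(** * Greedy embedding into a very dense graph *)

Lemma subgraph_of_large_degree (R : realFieldType) (H G : sgraph) (d : nat) (delta : R) :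
    degenerate d H -> (0 < #|H|)%N -> 0 <= delta ->
    (forall v : G, #|G|%:R - delta <= (degree v)%:R) ->
    d%:R * delta + #|H|%:R <= #|G|%:R ->
  is_subgraph H G.
Proof.
move=> degH H0 delta0 deg_ge largeG.
have [s [us s_all deg_s]] := degenerate_order degH.
have size_s : size s = #|H|.
  by rewrite -(card_uniqP us); apply: eq_card => u; rewrite s_all inE.
have /card_gt0P[w0 _] : (0 < #|G|)%N.
  rewrite -(ltr0n R); apply: lt_le_trans largeG.
  by rewrite ltr_wpDl ?mulr_ge0 // ltr0n.
(* Each open neighbour of [u] may still remove [delta] candidates, and any other vertex at most
   one. *)
pose inv s (C : H -> {set G}) := {in s, forall u,
  (back_degree s u)%:R * delta + (size s)%:R <= #|C u|%:R :> R}.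
have inv0 : inv s (fun=> [set: G]).
  move=> u _; rewrite cardsT; apply: le_trans largeG; rewrite size_s lerD2r.
  by rewrite ler_wpM2r // ler_nat.
suff step x t C : uniq (x :: t) -> inv (x :: t) C ->
    exists2 w, w \in C x & inv t (restrict_candidates x w C).
  have [phi [inj_phi _ phi_adj]] := embedding_of_invariant w0 step us inv0.
  by exists phi => [u v|u v]; [apply: inj_phi | apply: phi_adj].
case/andP=> xt ut invC.
have /card_gt0P[w Cw] : (0 < #|C x|)%N.
  rewrite -(ltr0n R); apply: lt_le_trans (invC x (mem_head x t)).
  by rewrite ltr_wpDl ?mulr_ge0.
exists w => // u tu; have := invC u.
rewrite inE tu orbT back_degree_tail // => /(_ isT).
rewrite /restrict_candidates -[size (x :: t)]/(size t).+1 -natr1 natrD.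
case: (adj x u) => [|] le_C.
  have : (#|C u| + degree w)%:R <= (#|C u :&: nbh w| + #|G|)%:R :> R.
    by rewrite ler_nat -card_nbh -cardsUI addnC leq_add2l max_card.
  rewrite !natrD; have := deg_ge w; move: le_C; rewrite mulrDl mul1r; lra.
have : #|C u|%:R <= #|C u :\ w|%:R + 1 :> R.
  by rewrite natr1 ler_nat (cardsD1 w (C u)) -add1n leq_add2r leq_b1.
move: le_C; rewrite add0r; lra.
Qed.

(** * Dependent random choice *)

Section DependentRandomChoice.
Variables (R : realFieldType) (G : sgraph).
Implicit Types (D W X Y : {set G}) (T t : seq G).

(** After exchanging the sums, a fixed [t] is counted once for each [T] in the [b]-th power of
    [D :&: common_nbh t], which cancels the denominator. The [+ 1] there avoids division by zero. *)
Lemma seqsum_common_nbh D W r b :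
  seqsum b D (fun T => seqsum r (W :&: common_nbh T)
    (fun t => (#|D|%:R / #|D :&: common_nbh t|.+1%:R) ^+ b)) <=
  #|D|%:R ^+ b * #|W|%:R ^+ r :> R.
Proof.
pose c t : R := (#|D|%:R / #|D :&: common_nbh t|.+1%:R) ^+ b.
rewrite (eq_seqsum _ _ (g := fun T => seqsum r W
  (fun t => (all (mem (common_nbh t)) T)%:R * c t))); last first.
  by move=> T; rewrite seqsum_setI; apply: eq_seqsum => t; rewrite all_common_nbhC.
rewrite seqsum_exchange mulrC -seqsum_const; apply: le_seqsum => t.
rewrite -seqsum_setI seqsum_const -exprMn lerXn2r ?nnegrE ?mulr_ge0 ?invr_ge0 //.
by rewrite mulrA ler_pdivrMr // mulrC ler_wpM2l // ler_nat.
Qed.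

Lemma sum_card_common_nbh b (delta : R) :
    0 <= delta -> (forall v : G, delta <= (degree v)%:R) ->
  #|G|%:R * delta ^+ b <= seqsum b [set: G] (fun T => #|common_nbh T|%:R).
Proof.
move=> delta0 deg_ge.
rewrite (eq_seqsum _ _ (g := fun T => \sum_(v in [set: G])
  (all (mem (nbh v)) T)%:R * 1)) => [|T]; last first.
  rewrite -sum1_card natr_sum big_mkcond /=; apply: eq_big => v; rewrite ?inE // mulr1 => _.
  by rewrite (eq_all (a2 := adj v)) => [|w]; [case: all | rewrite /= inE].
by rewrite seqsum_sum -cardsT mulr_natl -sumr_const; apply: ler_sum => v _;
  rewrite -seqsum_setI seqsum_const mulr1 setTI card_nbh lerXn2r ?nnegrE //.
Qed.

(** Take [X = common_nbh T] for a [b]-tuple [T] of [G], then [Y = common_nbh U] for a [b]-tuple [U]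
    of [X]. Moments over [(b + d)]-tuples of [X] are controlled first: [b] entries then serve as
    [U], the other [d] as the tuple tested against [Y]. *)
Lemma dependent_random_choice (alpha : R) b d :
    (0 < b)%N -> (d <= b)%N -> 0 < alpha <= 1 -> (0 < #|G|)%N ->
    (forall v : G, alpha * #|G|%:R <= (degree v)%:R) ->
  let K := (2 / alpha ^+ b) ^+ (b + d).+1 in
  exists X Y, [/\ #|G|%:R <= 2 / alpha ^+ b * #|X|%:R, (0 < #|Y|)%N,
    #|X|%:R ^- d * seqsum d X
      (fun t => (#|G|%:R / #|Y :&: common_nbh t|.+1%:R) ^+ b) <= 2 * K &
    #|Y|%:R ^- d * seqsum d Y
      (fun t => (#|X|%:R / #|X :&: common_nbh t|.+1%:R) ^+ b) <= 6 * 2 ^+ d * K].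
Proof.
move=> b0 db /andP[alpha0 alpha1] G0 deg_ge K.
set m : R := #|G|%:R; have m0 : 0 < m by rewrite ltr0n.
have ab0 : 0 < alpha ^+ b by rewrite exprn_gt0.
have ab1 : alpha ^+ b <= 1 by rewrite exprn_ile1 // ltW.
set q := 2 / alpha ^+ b; have q1 : 1 <= q by rewrite ler_pdivlMr // mul1r; lra.
have q0 : 0 < q by lra.
pose f T := seqsum (b + d) (common_nbh T)
  (fun t => (m / #|common_nbh t|.+1%:R) ^+ b).
have sumf : seqsum b [set: G] f <= m ^+ b * m ^+ (b + d).
  have := seqsum_common_nbh [set: G] [set: G] (b + d) b.
  rewrite cardsT; apply: le_trans; rewrite le_eqVlt; apply/orP; left; apply/eqP.
  apply: eq_seqsum => T; rewrite setTI; apply: eq_seqsum => t.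
  by rewrite setTI.
have sumcard := sum_card_common_nbh b (mulr_ge0 (ltW alpha0) (ltW m0)) deg_ge.
have mbd0 : 0 < m ^+ (b + d) by rewrite exprn_gt0.
(* The mean of [#|common_nbh T| / m] is at least [2 / q] and that of [f T / m ^ (b + d)] at most 1,
   so the combination has mean at least [1 / q]. It bounds [#|X|] from below and [f T] from
   above. *)
have [T [sT _ T_ge]] : exists T, [/\ size T = b, all (mem [set: G]) T &
    q^-1 <= #|common_nbh T|%:R / m - q^-1 * (f T / m ^+ (b + d))].
  apply: exists_seqsum_ge; first by rewrite cardsT.
  rewrite cardsT -/m.
  rewrite (eq_seqsum _ _ (g := fun T => m^-1 * #|common_nbh T|%:R +
    - (q^-1 / m ^+ (b + d)) * f T)); last by move=> T; ring.
  rewrite seqsumD !seqsumZ.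
  have h1 : m ^+ b * (2 * q^-1) <= m^-1 * seqsum b [set: G] (fun T => #|common_nbh T|%:R).
    rewrite ler_pdivlMl // (le_trans _ sumcard) // exprMn /q invf_div.
    rewrite mulrC le_eqVlt; apply/orP; left; apply/eqP; field.
    by rewrite ?gt_eqF.
  have h2 : q^-1 / m ^+ (b + d) * seqsum b [set: G] f <= m ^+ b * q^-1.
    rewrite mulrAC ler_pdivrMr // mulrAC [X in _ <= X]mulrC.
    by rewrite ler_wpM2l ?invr_ge0 ?(ltW q0).
  move: h1 h2; rewrite mulNr [m ^+ b * (2 * _)]mulrCA.
  move: (m ^+ b * _) (_^-1 * seqsum _ _ _) (_ / _ * seqsum _ _ _) => u v w; lra.
set X := common_nbh T in T_ge *.
have fT0 : 0 <= f T / m ^+ (b + d).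
  rewrite divr_ge0 ?(ltW mbd0) // seqsum_ge0 // => t.
  by rewrite exprn_ge0 // divr_ge0 // ltW.
have Xm : m <= q * #|X|%:R.
  have : q^-1 <= #|X|%:R / m by apply: (le_trans T_ge); rewrite gerBl mulr_ge0 // invr_ge0 ltW.
  by rewrite ler_pdivlMr // ler_pdivrMl.
have fT : f T <= q * m ^+ (b + d).
  have : q^-1 * (f T / m ^+ (b + d)) <= 1.
    have : #|X|%:R / m <= 1 by rewrite ler_pdivrMr // mul1r ler_nat max_card.
    have : 0 < q^-1 by rewrite invr_gt0.
    lra.
  by rewrite ler_pdivrMl // mulr1 ler_pdivrMr.
have X0R : 0 < #|X|%:R :> R by rewrite -(pmulr_rgt0 _ q0) (lt_le_trans m0).
have X0 : (0 < #|X|)%N by rewrite -(ltr0n R).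
have K1 : 1 <= K by rewrite exprn_ege1.
have K0 : 0 < K by apply: lt_le_trans K1.
pose g U := #|X|%:R ^- d * seqsum d X (fun t => (m / #|common_nbh (U ++ t)|.+1%:R) ^+ b).
pose h U := m ^- d * seqsum d (common_nbh U)
  (fun t => (#|X|%:R / #|X :&: common_nbh t|.+1%:R) ^+ b).
have sumg : seqsum b X g <= #|X|%:R ^+ b * K.
  rewrite seqsumZ.
  have <- : f T = seqsum b X (fun U => seqsum d X
      (fun t => (m / #|common_nbh (U ++ t)|.+1%:R) ^+ b)) by rewrite /f seqsum_cat.
  rewrite ler_pdivrMl ?exprn_gt0 //.
  apply: (le_trans fT); rewrite mulrA -exprD [(d + b)%N]addnC /K -/q exprS mulrCA.
  rewrite ler_wpM2l ?(ltW q0) // -exprMn [_ * q]mulrC.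
  by rewrite lerXn2r ?nnegrE ?(ltW m0) // mulr_ge0 ?(ltW q0).
have sumh : seqsum b X h <= #|X|%:R ^+ b.
  rewrite seqsumZ ler_pdivrMl ?exprn_gt0 //.
  have := seqsum_common_nbh X [set: G] d b; rewrite cardsT -/m mulrC.
  by apply: le_trans; apply: le_seqsum => U; rewrite setTI.
have [U [sU XU U_ge]] : exists U, [/\ size U = b, all (mem X) U & -2 <= - (g U / K + h U)].
  apply: exists_seqsum_ge => //.
  rewrite (eq_seqsum _ _ (g := fun U => -1 * (K^-1 * g U + h U))); last by move=> U; ring.
  rewrite seqsumZ seqsumD seqsumZ.
  have : K^-1 * seqsum b X g <= #|X|%:R ^+ b by rewrite ler_pdivrMl // [X in _ <= X]mulrC.
  move: sumh; lra.
have g0 : 0 <= g U.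
  rewrite mulr_ge0 ?invr_ge0 ?exprn_ge0 // seqsum_ge0 // => t.
  by rewrite exprn_ge0 // divr_ge0 // ltW.
have h0 : 0 <= h U.
  apply: mulr_ge0; first by rewrite invr_ge0 exprn_ge0 // ltW.
  by apply: seqsum_ge0 => t; rewrite exprn_ge0 // divr_ge0.
have gK0 : 0 <= g U / K by rewrite divr_ge0 // ltW.
have gU : g U <= 2 * K by rewrite -ler_pdivrMr //; lra.
have hU : h U <= 2 by lra.
set Y := common_nbh U.
(* The entries of [T] are adjacent to all of [X], hence lie in [Y]. *)
have Y0 : (0 < #|Y|)%N.
  have [v Tv] : exists v, v \in T.
    by case: (T) sT b0 => [<-//|v T' _ _]; exists v; rewrite mem_head.
  apply/card_gt0P; exists v; move: XU; rewrite all_common_nbhC => /allP.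
  exact.
exists X, Y; split=> //.
  apply: le_trans gU; rewrite ler_wpM2l ?invr_ge0 ?exprn_ge0 //.
  by apply: le_seqsum => t; rewrite common_nbh_cat.
have Y0R : 0 < #|Y|%:R :> R by rewrite ltr0n.
(* All sets counted in [g U] lie in [Y], so [Y] is not small; this converts the normalisation
   [m ^ d] of [h U] into [#|Y| ^ d]. *)
have Ymb : (m / #|Y|.+1%:R) ^+ b <= 2 * K.
  apply: le_trans gU; rewrite ler_pdivlMl ?exprn_gt0 // -seqsum_const.
  apply: le_seqsum => t.
  rewrite lerXn2r ?nnegrE ?divr_ge0 ?(ltW m0) // ler_pM2l // lef_pV2 ?posrE //.
  by rewrite ler_nat ltnS common_nbh_cat subset_leq_card // subsetIl.
have YK : (m / #|Y|%:R) ^+ d <= 2 ^+ d * (3 * K).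
  set r := m / #|Y|.+1%:R in Ymb; have r0 : 0 <= r by rewrite divr_ge0 // ltW.
  have rd : r ^+ d <= 3 * K.
    have [r1|/ltW r1] := lerP r 1; first by rewrite (le_trans (exprn_ile1 _ r0 r1)) //; lra.
    by rewrite (le_trans (ler_weXn2l r1 db)) // (le_trans Ymb) //; lra.
  apply: le_trans (ler_wpM2l (exprn_ge0 d (ler0n R 2)) rd).
  rewrite -exprMn lerXn2r ?nnegrE ?mulr_ge0 ?divr_ge0 ?(ltW m0) //.
  rewrite /r mulrCA ler_pM2l // ler_pdivlMr // mulrC ler_pdivrMr //.
  by rewrite -natrM ler_nat; move: Y0; clear; lia.
have -> : #|Y|%:R ^- d * seqsum d Y
    (fun t => (#|X|%:R / #|X :&: common_nbh t|.+1%:R) ^+ b) =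
    (m / #|Y|%:R) ^+ d * h U.
  rewrite /h expr_div_n mulrA; congr (_ * _).
  by rewrite mulrAC mulfV ?mul1r // gt_eqF // exprn_gt0.
apply: (le_trans (ler_pM _ h0 YK hU)); first by rewrite exprn_ge0 // divr_ge0 // ltW.
by rewrite le_eqVlt; apply/orP; left; apply/eqP; ring.
Qed.

End DependentRandomChoice.

(** * Choice of the constants and conclusion *)

Lemma mean_scarcity_le_moment (R : realFieldType) (G : sgraph) (M c n : R) (a : nat)
    (W C : {set G}) i l :
    0 <= M -> 0 <= c -> 0 <= n -> (0 < a)%N -> M <= c * n ->
  mean_scarcity M a W i l C <=
  c ^+ l.*2 * (#|W|%:R ^- i *
    seqsum i W (fun t => (n / #|C :&: common_nbh t|.+1%:R) ^+ l.*2)).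
Proof.
move=> M0 c0 n0 a0 Mc; rewrite mulrCA -seqsumZ ler_wpM2l ?invr_ge0 ?exprn_ge0 //.
apply: le_seqsum => t; rewrite -exprMn lerXn2r ?nnegrE ?mulr_ge0 ?invr_ge0 // mulrA.
apply: ler_pM; rewrite ?invr_ge0 // lef_pV2 ?posrE ?ltr0n ?addn_gt0 ?a0 ?orbT //.
by rewrite ler_nat -addn1 leq_add2l.
Qed.

(** Bernoulli gives [(2 - alpha) ^ (2 * d) >= 1 + 2 * d * (1 - alpha) >= 2], while
    [alpha * (2 - alpha) <= 1]. *)
Lemma expr_double_le_half (R : realFieldType) (alpha : R) d :
  0 < alpha <= 1 -> 1 / 2 <= d%:R * (1 - alpha) -> alpha ^+ (2 * d) <= 1 / 2.
Proof.
case/andP=> alpha0 alpha1 big.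
have e1 : 1 + (2 * d)%:R * (1 - alpha) <= (2 - alpha) ^+ (2 * d).
  elim: (2 * d)%N => [|k IHk]; first by rewrite expr0; lra.
  have le_s := ler_wpM2l (_ : 0 <= 2 - alpha) IHk.
  rewrite exprS -natr1; apply: le_trans (le_s _); last by lra.
  have : 0 <= k%:R * (1 - alpha) ^+ 2 by rewrite mulr_ge0 // sqr_ge0.
  by rewrite expr2; lra.
have e2 : 2 <= (2 - alpha) ^+ (2 * d) by move: e1; rewrite natrM; lra.
have e3 : alpha ^+ (2 * d) * (2 - alpha) ^+ (2 * d) <= 1.
  by rewrite -exprMn exprn_ile1 //; nra.
have e4 : 0 < alpha ^+ (2 * d) by rewrite exprn_gt0.
nra.
Qed.

Lemma subgraph_of_dense (R : realFieldType) (H G : sgraph) (d : nat) (alpha : R) :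
    (0 < d)%N -> 0 < alpha <= 1 -> 1 / 2 <= d%:R * (1 - alpha) ->
    (forall v : G, alpha * #|G|%:R <= (degree v)%:R) ->
    degenerate d H -> bipartite H -> (0 < #|H|)%N ->
    2 ^+ 21 * d%:R * #|H|%:R <= alpha ^+ (72 * d) * #|G|%:R ->
  is_subgraph H G.
Proof.
move=> d0 alpha01 big deg_ge degH [side side_adj] H0 largeG.
have /andP[alpha0 alpha1] := alpha01.
set m : R := #|G|%:R in deg_ge largeG.
have dR : 1 <= d%:R :> R by rewrite ler1n.
have H1 : 1 <= #|H|%:R :> R by rewrite ler1n.
have kap0 : 0 < alpha ^+ (72 * d) by rewrite exprn_gt0.
have kap1 : alpha ^+ (72 * d) <= 1 by rewrite exprn_ile1 // ltW.
have dm : 12 * d%:R <= m by nra.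
have G0 : (0 < #|G|)%N by rewrite -(ltr0n R) -/m; lra.
have m0 : 0 < m by rewrite ltr0n.
(* The moment order [6 * d] is the scarcity exponent for [l = 3 * d]. *)
have b0 : (0 < 6 * d)%N by rewrite muln_gt0.
have db : (d <= 6 * d)%N by rewrite leq_pmull.
have [X [Y [Xm Y0 momX momY]]] := dependent_random_choice b0 db alpha01 G0 deg_ge.
pose B := alpha ^- (2 * d).
have B2 : 2 <= B.
  rewrite /B -[2]invrK lef_pV2 ?posrE ?exprn_gt0 ?invr_gt0 //.
  by rewrite -div1r expr_double_le_half.
have B0 : 0 < B by lra.
have B1 : 1 <= B by lra.
have BX k : B ^+ k = alpha ^- (2 * d * k) by rewrite /B exprVn -exprM.
have qE : 2 / alpha ^+ (6 * d) = 2 * B ^+ 3.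
  by rewrite BX; congr (_ / _ ^+ _); clear; lia.
rewrite qE in Xm momX momY.
set K := (2 * B ^+ 3) ^+ _ in momX momY.
have KB : K <= B ^+ (32 * d).
  rewrite /K (le_trans (_ : _ <= (B ^+ 4) ^+ (6 * d + d).+1)) //.
    apply: lerXn2r; rewrite ?nnegrE ?mulr_ge0 ?exprn_ge0 ?(ltW B0) //.
    by rewrite (exprS B 3) ler_wpM2r ?exprn_ge0 ?(ltW B0).
  by rewrite -exprM ler_weXn2l //; move: d0; clear; lia.
have K0 : 0 <= K by rewrite exprn_ge0 // mulr_ge0 ?exprn_ge0 ?(ltW B0).
pose M : R := 2 * (m + (12 * d)%:R).
have M4 : M <= 4 * m by rewrite /M natrM; lra.
have M0 : 0 <= M by rewrite /M mulr_ge0 // addr_ge0 // ltW.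
(* [Q ^ (2 * d)] is then the loss [alpha ^- (72 * d)] allowed for [H], and
   [Q ^ (8 * d ^ 2) = B ^ (144 * d)] leaves room for all moment bounds. *)
pose Q := alpha ^- 36.
have QE k : Q ^+ k = alpha ^- (36 * k) by rewrite /Q exprVn -exprM.
have QB : Q ^+ (8 * d ^ 2) = B ^+ (144 * d).
  by rewrite QE BX; congr (_ ^- _); rewrite expnS expn1; clear; lia.
have a0 : (0 < 12 * d)%N by rewrite muln_gt0.
have l6 : (3 * d).*2 = (6 * d)%N by clear; lia.
apply: (@subgraph_of_mean_scarcity R H G side (fun b => if b then X else Y) d Q M) => //.
- by rewrite /Q -exprVn exprn_ege1 // invf_ge1.
- case=> //; have c0 : 0 < 2 * B ^+ 3 by rewrite mulr_gt0 ?exprn_gt0.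
  by rewrite -(ltr0n R) -(pmulr_rgt0 _ c0) (lt_le_trans m0).
- move=> b; rewrite /M ler_wpM2l // (le_trans (_ : _ <= m)) ?lerDl //.
  by rewrite ler_nat max_card.
- rewrite natrD -/m /M; have : 0 <= (12 * d)%:R :> R by []. lra.
- rewrite QE invrK [(36 * _)%N](_ : _ = 72 * d)%N; last by clear; lia.
  apply: (@le_trans _ _ (2 ^+ 21 * d%:R * #|H|%:R)).
    rewrite !natrM !ler_wpM2r //.
    apply: (@le_trans _ _ (2 ^+ 7)); first by rewrite -natrX ler_nat.
    by rewrite ler_weXn2l // ler1n.
  rewrite (le_trans largeG) // ler_wpM2l ?(ltW kap0) // /M.
  have : 0 <= (12 * d)%:R :> R by [].
  lra.
- have B3 : 0 <= B ^+ 3 by rewrite exprn_ge0 ?(ltW B0).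
  have p2 k : 2 ^+ k <= B ^+ k by rewrite lerXn2r ?nnegrE ?(ltW B0).
  rewrite QB; case.
    have c0 : 0 <= 4 * (2 * B ^+ 3) by rewrite mulr_ge0 // mulr_ge0.
    have Mc : M <= 4 * (2 * B ^+ 3) * #|X|%:R by rewrite -mulrA (le_trans M4) // ler_wpM2l.
    apply: (le_trans (mean_scarcity_le_moment Y X d (3 * d) M0 c0 (ler0n R #|X|) a0 Mc)).
    rewrite l6; apply: (le_trans (ler_wpM2l (exprn_ge0 _ c0) momY)).
    have e1 : (4 * (2 * B ^+ 3)) ^+ (6 * d) <= (B ^+ 6) ^+ (6 * d).
      apply: lerXn2r; rewrite ?nnegrE ?exprn_ge0 ?(ltW B0) //.
      have -> : 4 * (2 * B ^+ 3) = 2 ^+ 3 * B ^+ 3 by ring.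
      by rewrite (exprD B 3 3) ler_wpM2r.
    have e3 : 6 <= B ^+ 3 by apply: (le_trans _ (p2 3%N)); lra.
    have e2 : 6 * 2 ^+ d <= B ^+ 3 * B ^+ d by apply: ler_pM; rewrite ?exprn_ge0.
    have c2 : 0 <= 6 * 2 ^+ d :> R by rewrite mulr_ge0 ?exprn_ge0.
    apply: (le_trans (ler_pM (exprn_ge0 _ c0) (mulr_ge0 c2 K0) e1 (ler_pM c2 K0 e2 KB))).
    by rewrite -exprM -!exprD ler_weXn2l //; move: d0; clear; lia.
  apply: (le_trans (mean_scarcity_le_moment X Y d (3 * d) M0 (ler0n R 4) (ltW m0) a0 M4)).
  rewrite l6; apply: (le_trans (ler_wpM2l (exprn_ge0 _ (ler0n R 4)) momX)).
  have e1 : 4 ^+ (6 * d) <= (B ^+ 2) ^+ (6 * d).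
    apply: lerXn2r; rewrite ?nnegrE ?exprn_ge0 ?(ltW B0) //.
    by apply: (le_trans _ (p2 2%N)); lra.
  have c2 : 0 <= 2 * K by rewrite mulr_ge0.
  have c1 : 0 <= 4 ^+ (6 * d) :> R by rewrite exprn_ge0.
  apply: (le_trans (ler_pM c1 c2 e1 (ler_pM (ler0n R 2) K0 (p2 1%N) KB))).
  by rewrite -exprM -!exprD ler_weXn2l //; move: d0; clear; lia.
Qed.

Theorem theorem5p5 (R : realType) :
  exists c : R, 0 < c /\
    forall (d : nat) (alpha : R), (0 < d)%N -> 0 < alpha ->
    forall m : nat, powR alpha (- (c * d%:R ^+ 2)) <= m%:R ->
    forall G : sgraph, #|G| = m ->
      (forall v : G, alpha * m%:R <= (degree v)%:R) ->
      universal G (fun H : sgraph =>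
        [/\ degenerate d H, bipartite H &
            #|H|%:R <= d%:R^-1 * 2 ^- 21 * alpha ^+ (72 * d) * m%:R]).
Proof.
exists 1; split=> // d alpha d0 alpha0 _ _ G <- deg_ge H [degH bipH smallH].
have [H0|H0] := posnP #|H|.
  have no_vertex (u : H) : False by have := card0_eq H0 u; rewrite inE.
  by exists (fun u => False_rect G (no_vertex u)) => u; case: (no_vertex u).
have H1 : 1 <= #|H|%:R :> R by rewrite ler1n.
have dR : 1 <= d%:R :> R by rewrite ler1n.
have d0R : 0 < d%:R :> R by rewrite ltr0n.
have largeG : 2 ^+ 21 * d%:R * #|H|%:R <= alpha ^+ (72 * d) * #|G|%:R.
  rewrite -[X in X <= _]mulrA -ler_pdivlMl ?exprn_gt0 // -ler_pdivlMl //.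
  by move: smallH; rewrite -2!mulrA.
have kap0 : 0 < alpha ^+ (72 * d) by rewrite exprn_gt0.
have dH : 1 <= d%:R * #|H|%:R :> R by rewrite -natrM ler1n muln_gt0 d0.
have G0 : (0 < #|G|)%N.
  rewrite -(ltr0n R) -(pmulr_rgt0 _ kap0) (lt_le_trans _ largeG) // -mulrA.
  by rewrite mulr_gt0 ?exprn_gt0 // (lt_le_trans ltr01).
have m0 : 0 < #|G|%:R :> R by rewrite ltr0n.
have alpha1 : alpha <= 1.
  have /card_gt0P[v _] := G0; rewrite -(ler_pM2r m0) mul1r (le_trans (deg_ge v)) //.
  by rewrite ler_nat max_card.
have [big|/ltW small] := lerP (1 / 2) (d%:R * (1 - alpha)).
  by apply: (subgraph_of_dense d0 _ big deg_ge); rewrite ?alpha0.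
apply: (@subgraph_of_large_degree R H G d ((1 - alpha) * #|G|%:R)) => //.
- by rewrite mulr_ge0 // subr_ge0.
- by move=> v; move: (deg_ge v); lra.
have kap1 : alpha ^+ (72 * d) <= 1 by rewrite exprn_ile1 // ltW.
(* Here [d] neighbours exclude at most [#|G| / 2] vertices, so [#|H| <= #|G| / 2] suffices. *)
have Hm : 2 ^+ 21 * #|H|%:R <= #|G|%:R :> R.
  apply: (@le_trans _ _ (2 ^+ 21 * d%:R * #|H|%:R)).
    by rewrite -mulrA ler_wpM2l ?exprn_ge0 // ler_peMl.
  by rewrite (le_trans largeG) // ger_pMl.
have e21 : 2 <= 2 ^+ 21 :> R by rewrite -{1}[2]expr1 ler_weXn2l // ler1n.
have := ler_wpM2r (ltW m0) small; have := ler_wpM2r (ler0n R #|H|) e21; lra.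
Qed.
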